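(* For positive integers $N,W$ let $-\Delta_{N,W}=(h_{ij})_{1\le i,j\le N}$ be the $N\times N$ matrix with $h_{ii}=2W$, $h_{ij}=-1$ if $1\le|i-j|\le W$, and $h_{ij}=0$ otherwise. Let $\lambda_{N,W}$ be its smallest eigenvalue and $u_{N,W}=(-\Delta_{N,W})^{-1}\mathbf 1$, where $\mathbf 1\in\mathbb R^N$ is the all-ones vector. Then for any positive integer $W$, $$\lim_{N\to\infty}\lambda_{N,W}\,\|u_{N,W}\|_\infty=\frac{\pi^2}{8}.$$
   Context: $\|v\|_\infty=\max_n|v(n)|$. The matrix $-\Delta_{N,W}$ is strictly positive definite, hence invertible. *)

(* Defs.v *)
From HB Require Import structures.
From mathcomp Require Import all_boot all_order all_algebra.
From mathcomp Require Import all_classical all_reals all_analysis.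

Set Implicit Arguments.
Unset Strict Implicit.
Unset Printing Implicit Defensive.

Import Order.TTheory GRing.Theory Num.Theory.
Import numFieldNormedType.Exports.

Local Open Scope classical_set_scope.
Local Open Scope ring_scope.

(* The matrix $-\Delta_{N,W}$; the truncation to [1, N] amounts to a Dirichlet
   condition, so the diagonal is 2W in every row. *)
Definition neg_laplacian (R : realType) (N W : nat) : 'M[R]_N :=
  \matrix_(i < N, j < N)
    if i == j then (2 * W)%:R
    else if (1 <= `|i%:Z - j%:Z| <= W)%N then -1
    else 0.

Definition is_smallest_eigenvalue (R : realType) (N : nat) (A : 'M[R]_N)
    (a : R) : Prop :=
  eigenvalue A a /\ forall b : R, eigenvalue A b -> a <= b.

(* The default 0 is only returned when there is no smallest eigenvalue, which
   for the symmetric matrices considered here happens only when N = 0. *)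
Definition smallest_eigenvalue (R : realType) (N : nat) (A : 'M[R]_N) : R :=
  xget 0 [set a | is_smallest_eigenvalue A a].

(* u_{N,W}: the solution of -\Delta u = 1. For W > 0 the matrix is positive
   definite, so invmx is the actual inverse. The library norm on matrices is
   the maximum of the absolute values of the entries, i.e. the sup norm of u
   (see mx_normrE). *)
Definition torsion_function (R : realType) (N W : nat) : 'cV[R]_N :=
  invmx (neg_laplacian R N W) *m const_mx 1.

(* Main.v *)
Require Import Defs.
From HB Require Import structures.
From mathcomp Require Import all_boot all_order all_algebra.
From mathcomp Require Import all_classical all_reals all_analysis.
From mathcomp Require Import ring lra zify.

(* Up to boundary terms, the matrix acts on a function g as the sum over
   1 <= k <= W of its second differences -g(x-k) + 2 g(x) - g(x+k). Quadratics
   and sines are explicit solutions of the second-difference equation. Such a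
   solution which is nonnegative on the two boundary layers of width W is a
   supersolution of the matrix problem, and one which is nonpositive there is a
   subsolution. The off-diagonal entries being nonpositive, the comparison
   principle squeezes the torsion function between x(N+1-x)/(2s) and
   (x+W)(N+1+W-x)/(2s), where s = 1^2 + ... + W^2. The positive function
   sin(pi(x+W)/(N+1+2W)) bounds every eigenvalue from below, and inserting
   sin(pi x/(N+1)) in the Rayleigh quotient bounds the smallest one from above,
   by values which are both equivalent to s pi^2/N^2. *)

Set Implicit Arguments.
Unset Strict Implicit.
Unset Printing Implicit Defensive.

Import Order.TTheory GRing.Theory Num.Theory.
Import numFieldNormedType.Exports.

Local Open Scope classical_set_scope.
Local Open Scope ring_scope.

(** * Comparison principle for matrices with nonpositive off-diagonal entries *)

Lemma zmatrix_comparison (R : realFieldType) (n : nat) (A : 'M[R]_n)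
    (f w : 'cV[R]_n) :
  (forall i j, i != j -> A i j <= 0) ->
  (forall i, 0 < f i 0) -> (forall i, 0 < (A *m f) i 0) ->
  (forall i, 0 <= (A *m w) i 0) -> forall i, 0 <= w i 0.
Proof.
move=> A_le0 f_gt0 Af_gt0 Aw_ge0 i0; rewrite leNgt; apply/negP => wi0_lt0.
(* At an index [k] minimizing [w / f], with negative minimum [q k], the vector [w - q k *: f] is
   nonnegative and vanishes at [k]. Row [k] of [A] then gives it a nonpositive value, whereas
   [A *m w - q k *: (A *m f)] is positive there. *)
pose q i := w i 0 / f i 0.
case: (arg_minP q (erefl : xpredT i0)) => k _ kmin.
have qk_lt0 : q k < 0.
  by apply: le_lt_trans (kmin i0 isT) _; rewrite pmulr_llt0 ?invr_gt0.
have : 0 < (A *m (w - q k *: f)) k 0.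
  rewrite mulmxBr -scalemxAr !mxE.
  have := Aw_ge0 k; have := Af_gt0 k; rewrite !mxE.
  by move=> ? ?; rewrite ltr_wpDl// -mulNr mulr_gt0// oppr_gt0.
rewrite ltNge mxE => /negP; apply; apply: sumr_le0 => j _.
have [->|kj] := eqVneq k j.
  by rewrite !mxE /q mulrVK ?subrr ?mulr0// unitfE gt_eqF.
rewrite mulr_le0_ge0// ?A_le0// !mxE subr_ge0.
by rewrite -ler_pdivlMr//; exact: kmin.
Qed.

Lemma zmatrix_ker (R : realFieldType) (n : nat) (A : 'M[R]_n)
    (f w : 'cV[R]_n) :
  (forall i j, i != j -> A i j <= 0) ->
  (forall i, 0 < f i 0) -> (forall i, 0 < (A *m f) i 0) ->
  A *m w = 0 -> w = 0.
Proof.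
move=> A_le0 f_gt0 Af_gt0 Aw.
have w_ge0 (u : 'cV[R]_n) : A *m u = 0 -> forall i, 0 <= u i 0.
  move=> Au; apply: (zmatrix_comparison A_le0 f_gt0 Af_gt0) => i.
  by rewrite Au mxE.
have Nw : A *m - w = 0 by rewrite mulmxN Aw oppr0.
apply/colP => i; have := w_ge0 _ Aw i; have := w_ge0 _ Nw i.
by rewrite !mxE oppr_ge0 => ? ?; apply/eqP; rewrite eq_le; apply/andP.
Qed.

(** If [b < a], then [A - b%:M] keeps the off-diagonal signs and maps [f] to a positive vector, so
    its kernel is trivial. Symmetry turns the row eigenvector into a column. *)
Lemma zmatrix_eigenvalue_ge (R : realFieldType) (n : nat) (A : 'M[R]_n)
    (f : 'cV[R]_n) (a b : R) :
  A^T = A -> (forall i j, i != j -> A i j <= 0) ->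
  (forall i, 0 < f i 0) -> (forall i, a * f i 0 <= (A *m f) i 0) ->
  eigenvalue A b -> a <= b.
Proof.
move=> Asym A_le0 f_gt0 Af_ge /eigenvalueP[v vA v0].
rewrite leNgt; apply/negP => ba; move/eqP: v0; apply; apply: trmx_inj.
rewrite trmx0; apply: (@zmatrix_ker _ _ (A - b%:M) f) => //.
- by move=> i j ij; rewrite !mxE (negbTE ij) subr0 A_le0.
- move=> i; rewrite mulmxBl mul_scalar_mx mxE [X in _ + X]mxE.
  rewrite [X in - X]mxE subr_gt0.
  by apply: lt_le_trans (Af_ge i); rewrite ltr_pM2r.
- rewrite mulmxBl mul_scalar_mx -[in A *m _]Asym -trmx_mul vA.
  by rewrite linearZ /= subrr.
Qed.

(** * Rayleigh quotient and smallest eigenvalue of a symmetric matrix *)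

Lemma quadratic_form_continuous (R : realType) (n : nat) (A : 'M[R]_n) :
  continuous (fun x : 'rV[R]_n => (x *m A *m x^T) 0 0).
Proof.
rewrite (_ : (fun _ => _) =
  fun y : 'rV[R]_n => \sum_j (\sum_i y 0 i * A i j) * y 0 j); last first.
  by apply/funext => y; rewrite mxE; apply: eq_bigr => j _; rewrite !mxE.
apply: (continuous_big (@add_continuous R)) => j _ x.
have lin_cont : continuous (fun y : 'rV[R]_n => \sum_i y 0 i * A i j).
  apply: (continuous_big (@add_continuous R)) => i _ z.
  by apply: continuousM; [exact: coord_continuous | exact: cst_continuous].
by apply: continuousM; [exact: lin_cont | exact: coord_continuous].
Qed.

Lemma row_normsqE (R : realType) (n : nat) (x : 'rV[R]_n) :
  (x *m x^T) 0 0 = \sum_i x 0 i ^+ 2.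
Proof. by rewrite mxE; apply: eq_bigr => i _; rewrite mxE expr2. Qed.

Lemma row_normsq_ge0 (R : realType) (n : nat) (x : 'rV[R]_n) :
  0 <= (x *m x^T) 0 0.
Proof. by rewrite row_normsqE; apply: sumr_ge0 => i _; rewrite sqr_ge0. Qed.

Lemma row_normsq_eq0 (R : realType) (n : nat) (x : 'rV[R]_n) :
  (x *m x^T) 0 0 = 0 -> x = 0.
Proof.
rewrite row_normsqE => /psumr_eq0P x0; apply/rowP => i; rewrite mxE.
by apply/eqP; rewrite -sqrf_eq0 x0// => j _; rewrite sqr_ge0.
Qed.

Lemma quadratic_formZ (R : realType) (n : nat) (A : 'M[R]_n) (c : R)
    (x : 'rV[R]_n) :
  ((c *: x) *m A *m (c *: x)^T) 0 0 = c ^+ 2 * (x *m A *m x^T) 0 0.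
Proof. by rewrite linearZ /= -scalemxAr -!scalemxAl !mxE mulrA expr2. Qed.

(** The form attains its minimum on the compact Euclidean unit sphere; homogeneity of degree two
    carries the bound to all vectors. *)
Lemma quadratic_form_min (R : realType) (n : nat) (A : 'M[R]_n.+1) :
  exists2 v : 'rV[R]_n.+1, (v *m v^T) 0 0 = 1 & forall x : 'rV[R]_n.+1,
    (v *m A *m v^T) 0 0 * (x *m x^T) 0 0 <= (x *m A *m x^T) 0 0.
Proof.
pose S := [set x : 'rV[R]_n.+1 | (x *m x^T) 0 0 = 1].
have normE (x : 'rV[R]_n.+1) : x *m x^T = x *m 1%:M *m x^T by rewrite mulmx1.
have S0 : S !=set0.
  exists (delta_mx 0 0); rewrite /S/= row_normsqE (bigD1 ord0)//= big1.
    by rewrite mxE !eqxx expr1n addr0.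
  by move=> i /negbTE i0; rewrite mxE i0 andbF expr0n.
have cS : compact S.
  apply: bounded_closed_compact; last first.
    rewrite (_ : S = (fun x : 'rV[R]_n.+1 => (x *m 1%:M *m x^T) 0 0) @^-1`
      [set 1]); last by apply/seteqP; split => x; rewrite /S/= normE.
    apply: preimage_closed; last exact: closed_eq.
    by move=> x _; exact: quadratic_form_continuous.
  exists 1; split => // M M_gt1 x Sx; apply: ltW; apply: le_lt_trans M_gt1.
  have -> : `|x| = mx_norm x by [].
  (* Boundedness refers to the sup norm: the square of each entry is at most the sum of squares,
     which is 1. *)
  rewrite mx_normrE; apply: bigmax_le => // -[i j] _ /=.
  rewrite ord1 -(@expr_le1 _ 2)// -normrX ger0_norm ?sqr_ge0//.
  rewrite -[leRHS]Sx row_normsqE (bigD1 j)//= lerDl.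
  by apply: sumr_ge0 => k _; rewrite sqr_ge0.
have [v] := EVT_min_rV S0 cS
  (continuous_subspaceT (@quadratic_form_continuous _ _ A)).
rewrite inE => Sv vmin; exists v => // x.
have [x0|x0] := eqVneq ((x *m x^T) 0 0) 0.
  by rewrite (row_normsq_eq0 x0) trmx0 !mulmx0 [X in _ * X]mxE [leRHS]mxE mulr0.
have x_gt0 : 0 < (x *m x^T) 0 0 by rewrite lt_def x0 row_normsq_ge0.
pose c := Num.sqrt ((x *m x^T) 0 0).
have c2 : c ^+ 2 = (x *m x^T) 0 0 by rewrite sqr_sqrtr ?ltW.
have := vmin (c^-1 *: x); rewrite quadratic_formZ exprVn c2.
rewrite ler_pdivlMl// mulrC; apply.
by rewrite inE /S/= normE quadratic_formZ mulmx1 exprVn c2 mulVf.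
Qed.

(** Moving from [v] by [t *: y] with [y = v *m B] changes the form by [2 t |y|^2 + O(t^2)], which
    would be negative for some [t < 0] unless [y = 0]. *)
Lemma psd_form_ker (R : realType) (n : nat) (B : 'M[R]_n) (v : 'rV[R]_n) :
  B^T = B -> (forall x : 'rV[R]_n, 0 <= (x *m B *m x^T) 0 0) ->
  (v *m B *m v^T) 0 0 = 0 -> v *m B = 0.
Proof.
move=> Bsym B_ge0 vBv; apply: row_normsq_eq0.
set y := v *m B; set s := (y *m y^T) 0 0; set c := (y *m B *m y^T) 0 0.
have yBv : (y *m B *m v^T) 0 0 = s.
  by rewrite /s -[RHS]/((y *m (v *m B)^T) 0 0) trmx_mul Bsym mulmxA.
have pert t : 0 <= t * s *+ 2 + t ^+ 2 * c.
  have := B_ge0 (v + t *: y).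
  rewrite linearD linearZ /= !mulmxDl !mulmxDr -!scalemxAr -!scalemxAl.
  rewrite !mxE -/y; move: vBv yBv; rewrite /s /c !mxE => -> ->.
  rewrite add0r mulr2n. by rewrite expr2 -!addrA -mulrA.
have c_ge0 : 0 <= c by exact: B_ge0.
have s_ge0 : 0 <= s by exact: row_normsq_ge0.
apply/eqP; rewrite eq_le s_ge0 andbT leNgt; apply/negP => s_gt0.
have c1 : 0 < c + 1 by lra.
(* The minimizing [t] would be [- s / c]; the denominator [c + 1] also covers [c = 0]. *)
have := pert (- (s / (c + 1))); apply/negP; rewrite -ltNge.
rewrite (_ : _ + _ = - ((s / (c + 1)) ^+ 2 * (c + 2))); last first.
  by field; rewrite gt_eqF.
by rewrite oppr_lt0 mulr_gt0 ?exprn_gt0 ?divr_gt0//; lra.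
Qed.

(** For the minimum [a] of the Rayleigh quotient, [A - a%:M] is positive semidefinite and its form
    vanishes at the minimizer, which is therefore an eigenvector. Every other eigenvalue is a value
    of the quotient. *)
Lemma smallest_eigenvalue_symmetric (R : realType) (n : nat)
    (A : 'M[R]_n.+1) : A^T = A ->
  exists2 a, is_smallest_eigenvalue A a &
    forall x : 'rV[R]_n.+1, a * (x *m x^T) 0 0 <= (x *m A *m x^T) 0 0.
Proof.
move=> Asym; have [v v1 vmin] := quadratic_form_min A.
set a := (v *m A *m v^T) 0 0 in vmin.
exists a => //; split.
  apply/eigenvalueP; exists v; last first.
    by apply/eqP => v0; move: v1 => /eqP; rewrite v0 mul0mx mxE eq_sym oner_eq0.
  have formB (x : 'rV[R]_n.+1) : (x *m (A - a%:M) *m x^T) 0 0 =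
      (x *m A *m x^T) 0 0 - a * (x *m x^T) 0 0.
    by rewrite mulmxBr mulmxBl mul_mx_scalar -scalemxAl !mxE.
  apply/eqP; rewrite -subr_eq0 -mul_mx_scalar -mulmxBr; apply/eqP.
  apply: psd_form_ker.
  - by rewrite linearB /= Asym tr_scalar_mx.
  - by move=> x; rewrite formB subr_ge0.
  - by rewrite formB v1 mulr1 subrr.
move=> b /eigenvalueP[x xA x0]; have := vmin x.
rewrite xA -scalemxAl [X in _ <= X]mxE ler_pM2r// lt_def row_normsq_ge0 andbT.
by apply: contra_neq x0 => /row_normsq_eq0.
Qed.

(** * The matrix as a sum of second differences plus boundary terms *)

Definition second_differences (R : realType) (W : nat) (g : nat -> R)
    (p : nat) : R :=
  \sum_(k < W) (2 * g p - g (p - k.+1)%N - g (p + k.+1)%N).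

(** The neighbours of the shifted index [i + W] at distance at most [W], written without truncated
    subtraction. *)
Definition within_band (W i p : nat) : bool :=
  (p != (i + W)%N) && (i <= p <= i + W + W)%N.

Lemma sum_within_band (R : realType) (N W : nat) (g : nat -> R) (i : 'I_N) :
  \sum_(0 <= p < N + W + W | within_band W i p) g p =
  \sum_(k < W) (g (i + W - k.+1)%N + g (i + W + k.+1)%N).
Proof.
have iN := ltn_ord i.
have shift a (F : nat -> R) :
    \sum_(a <= p < a + W) F p = \sum_(k < W) F (k + a)%N.
  have := @big_addn R 0 +%R 0 (a + W) a xpredT F.
  by rewrite add0n addKn big_mkord.
have full a b : (forall p, a <= p < b -> within_band W i p)%N ->
    \sum_(a <= p < b | within_band W i p) g p = \sum_(a <= p < b) g p.
  move=> band; rewrite big_nat_cond [RHS]big_nat_cond; apply: eq_bigl => p.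
  by have := band p; case: (a <= p < b)%N => // ->.
have empty a b : (forall p, a <= p < b -> ~~ within_band W i p)%N ->
    \sum_(a <= p < b | within_band W i p) g p = 0.
  move=> band; rewrite big_nat_cond big_pred0// => p.
  by have := band p; case: (a <= p < b)%N => // /(_ isT)/negbTE ->.
(* Cuts at the two ends of the band and around its centre: only the two blocks of length [W]
   contribute. The left one is reversed below so that [k] counts the distance to the centre. *)
rewrite (@big_cat_nat _ _ _ i)/=; [|lia|lia].
rewrite (@big_cat_nat _ _ _ (i + W)%N i)/=; [|lia|lia].
rewrite (@big_cat_nat _ _ _ (i + W).+1 (i + W)%N)/=; [|lia|lia].
rewrite (@big_cat_nat _ _ _ (i + W + W).+1 (i + W).+1)/=; [|lia|lia].
rewrite (empty 0%N); last by move=> p; rewrite /within_band; lia.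
rewrite (empty (i + W)%N); last by move=> p; rewrite /within_band; lia.
rewrite (empty (i + W + W).+1); last by move=> p; rewrite /within_band; lia.
rewrite !full ?add0r ?addr0; try by move=> p; rewrite /within_band; lia.
rewrite big_split /=; congr (_ + _).
  rewrite big_nat_rev shift.
  by apply: eq_bigr => k _; congr g; have := ltn_ord k; lia.
rewrite -addSn shift.
by apply: eq_bigr => k _; congr g; lia.
Qed.

(* Indices are shifted by W, so that the matrix acts on the middle part of
   the window [0, N + 2W) of g; the two sums are the boundary terms. *)
Lemma neg_laplacian_second_differences (R : realType) (N W : nat)
    (g : nat -> R) (i : 'I_N) :
  (neg_laplacian R N W *m \col_j g (j + W)%N) i 0 =
  second_differences W g (i + W)
    + (\sum_(0 <= p < W | within_band W i p) g p
      + \sum_(N + W <= p < N + W + W | within_band W i p) g p).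
Proof.
(* The matrix sees only the middle part of the band sum; comparison with the full band sum leaves
   the boundary terms. *)
have inner : (neg_laplacian R N W *m \col_j g (j + W)%N) i 0 =
    (2 * W)%:R * g (i + W)%N -
    \sum_(W <= p < N + W | within_band W i p) g p.
  have := @big_addn R 0 +%R 0 (N + W) W (within_band W i) g.
  rewrite add0n addnK big_mkord => ->; rewrite mxE.
  rewrite [X in _ - X]big_mkcond -[X in X - _](big_pred1_eq +%R i
    (fun j : 'I_N => (2 * W)%:R * g (j + W)%N)).
  rewrite [X in X - _]big_mkcond -sumrB; apply: eq_bigr => j _.
  rewrite !mxE /within_band eqn_add2r val_eqE eq_sym.
  have [->|ji] := eqVneq j i; first by rewrite subr0.
  have jiN : (j : nat) != i by rewrite val_eqE.
  rewrite andTb (_ : (1 <= `|i%:Z - j%:Z| <= W)%N =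
    (i <= j + W <= i + W + W)%N).
    by case: ifP => _; rewrite ?mulN1r ?mul0r sub0r// oppr0.
  by lia.
have := sum_within_band W g i.
rewrite (@big_cat_nat _ _ _ W)/=; [|lia|lia].
rewrite (@big_cat_nat _ _ _ (N + W)%N W)/=; [|lia|lia].
rewrite inner /second_differences.
move: (\sum_(0 <= p < W | _) _) (\sum_(W <= p < N + W | _) _)
  (\sum_(N + W <= p < N + W + W | _) _) => a m b abm.
under [in RHS]eq_bigr do rewrite -addrA -opprD.
rewrite sumrB -abm sumr_const card_ord -mulr_natl natrM.
ring.
Qed.

(** Cutting [g] off on the layers removes terms [- g p], so the boundary terms enter with a plus
    sign. *)
Lemma neg_laplacian_ge (R : realType) (N W : nat) (g : nat -> R) (i : 'I_N) :
  (forall p, (p < W)%N || (N + W <= p < N + W + W)%N -> 0 <= g p) ->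
  second_differences W g (i + W) <=
    (neg_laplacian R N W *m \col_j g (j + W)%N) i 0.
Proof.
move=> g_ge0; rewrite neg_laplacian_second_differences lerDl addr_ge0//.
  by rewrite big_nat_cond sumr_ge0// => p pW; apply: g_ge0; lia.
by rewrite big_nat_cond sumr_ge0// => p pW; apply: g_ge0; lia.
Qed.

Lemma neg_laplacian_le (R : realType) (N W : nat) (g : nat -> R) (i : 'I_N) :
  (forall p, (p < W)%N || (N + W <= p < N + W + W)%N -> g p <= 0) ->
  (neg_laplacian R N W *m \col_j g (j + W)%N) i 0 <=
    second_differences W g (i + W).
Proof.
move=> g_le0; rewrite neg_laplacian_second_differences gerDl.
rewrite -[leRHS]addr0 lerD//.
  by rewrite big_nat_cond sumr_le0// => p pW; apply: g_le0; lia.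
by rewrite big_nat_cond sumr_le0// => p pW; apply: g_le0; lia.
Qed.

Lemma neg_laplacian_sym (R : realType) (N W : nat) :
  (neg_laplacian R N W)^T = neg_laplacian R N W.
Proof. by apply/matrixP => i j; rewrite !mxE eq_sym distnC. Qed.

Lemma neg_laplacian_offdiag (R : realType) (N W : nat) (i j : 'I_N) :
  i != j -> neg_laplacian R N W i j <= 0.
Proof. by move=> /negbTE ij; rewrite mxE ij; case: ifP => // _; lra. Qed.

(** * Quadratics and sines under second differences, and the barriers *)

Definition band_moment (R : realType) (W : nat) : R :=
  \sum_(k < W) k.+1%:R ^+ 2.

(** Fourier symbol of the operator on the whole line, equivalent to [band_moment R W * t ^+ 2] as
    [t] tends to 0. *)
Definition band_symbol (R : realType) (W : nat) (t : R) : R :=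
  \sum_(k < W) (2 - 2 * cos (t * k.+1%:R)).

Lemma band_moment_gt0 (R : realType) (W : nat) :
  (0 < W)%N -> 0 < band_moment R W.
Proof.
case: W => // W _; rewrite /band_moment big_ord_recl ltr_wpDr//.
  by apply: sumr_ge0 => k _; exact: sqr_ge0.
Qed.

(** Since [k.+1 <= W <= p], the subtraction in [nat] does not truncate, and identities over the
    reals apply. *)
Lemma second_differences_nat (R : realType) (W : nat) (h : R -> R) (p : nat) :
  (W <= p)%N -> second_differences W (fun q => h q%:R) p =
  \sum_(k < W) (2 * h p%:R - h (p%:R - k.+1%:R) - h (p%:R + k.+1%:R)).
Proof.
move=> Wp; apply: eq_bigr => k _; rewrite natrD natrB//.
exact: leq_trans Wp.
Qed.

Lemma second_differences_quadratic (R : realType) (W : nat) (a b c : R)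
    (p : nat) : (W <= p)%N ->
  second_differences W (fun q => c * ((q%:R + a) * (b - q%:R))) p =
  2 * c * band_moment R W.
Proof.
move=> Wp.
rewrite (@second_differences_nat _ _ (fun x => c * ((x + a) * (b - x))) p)//.
by rewrite /band_moment mulr_sumr; apply: eq_bigr => k _; ring.
Qed.

(** From [sin (y - z) + sin (y + z) = 2 sin y cos z]. *)
Lemma second_differences_sin (R : realType) (W : nat) (t a : R) (p : nat) :
  (W <= p)%N -> second_differences W (fun q => sin (t * (q%:R + a))) p =
  band_symbol W t * sin (t * (p%:R + a)).
Proof.
move=> Wp; rewrite (@second_differences_nat _ _ (fun x => sin (t * (x + a))))//.
rewrite /band_symbol mulr_suml; apply: eq_bigr => k _.
rewrite (_ : t * (_ - _ + a) = t * (p%:R + a) - t * k.+1%:R); last ring.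
rewrite (_ : t * (_ + _ + a) = t * (p%:R + a) + t * k.+1%:R); last ring.
by rewrite sinB sinD; ring.
Qed.

(* The point x of [1, N] has index p = x - 1 + W in the shifted window. *)
Definition upper_barrier (R : realType) (N W p : nat) : R :=
  (2 * band_moment R W)^-1 * ((p%:R + 1) * ((N + W + W)%:R - p%:R)).

(** For [W > 0] its zeros [W - 1] and [N + W] are the innermost indices of the two boundary layers,
    which makes it nonpositive on both. The zeros [-1] and [N + 2W] of [upper_barrier] lie just
    outside the window. *)
Definition lower_barrier (R : realType) (N W p : nat) : R :=
  (2 * band_moment R W)^-1 *
    ((p%:R + (1 - W%:R)) * ((N + W)%:R - p%:R)).

(** * Comparison with the barriers and bounds on the torsion function *)

Lemma neg_laplacian_upper_barrier (R : realType) (N W : nat) (i : 'I_N) :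
  (0 < W)%N ->
  1 <= (neg_laplacian R N W *m \col_j upper_barrier R N W (j + W)) i 0.
Proof.
move=> W0; have s0 := band_moment_gt0 R W0.
apply: le_trans (neg_laplacian_ge _ _); last first.
  move=> p pW; apply: mulr_ge0; first by rewrite invr_ge0 mulr_ge0// ltW.
  apply: mulr_ge0; first by rewrite natr1.
  by rewrite subr_ge0 ler_nat; lia.
rewrite second_differences_quadratic ?leq_addl//.
by rewrite -mulrA [_^-1 * _]mulrC mulrA mulfV// mulf_neq0// gt_eqF.
Qed.

Lemma neg_laplacian_lower_barrier (R : realType) (N W : nat) (i : 'I_N) :
  (0 < W)%N ->
  (neg_laplacian R N W *m \col_j lower_barrier R N W (j + W)) i 0 <= 1.
Proof.
move=> W0; have s0 := band_moment_gt0 R W0.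
apply: le_trans (neg_laplacian_le _ _) _.
  move=> p pW; apply: mulr_ge0_le0; first by rewrite invr_ge0 mulr_ge0// ltW.
  rewrite addrA natr1; case: (ltnP p W) pW => pW /= pNW.
    by rewrite mulr_le0_ge0// ?subr_ge0 ?subr_le0 ler_nat; lia.
  by rewrite mulr_ge0_le0// ?subr_ge0 ?subr_le0 ler_nat; lia.
rewrite second_differences_quadratic ?leq_addl//.
by rewrite -mulrA [_^-1 * _]mulrC mulrA mulfV// mulf_neq0// gt_eqF.
Qed.

Lemma upper_barrier_gt0 (R : realType) (N W : nat) (i : 'I_N) :
  (0 < W)%N -> 0 < upper_barrier R N W (i + W).
Proof.
move=> W0; apply: mulr_gt0.
  by rewrite invr_gt0 mulr_gt0// band_moment_gt0.
apply: mulr_gt0; first by rewrite natr1.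
by rewrite subr_gt0 ltr_nat; have := ltn_ord i; lia.
Qed.

(** [upper_barrier] serves as the positive function with positive image required by
    [zmatrix_comparison]. *)
Lemma neg_laplacian_comparison (R : realType) (N W : nat) (w : 'cV[R]_N) :
  (0 < W)%N -> (forall i, 0 <= (neg_laplacian R N W *m w) i 0) ->
  forall i, 0 <= w i 0.
Proof.
move=> W0; apply: (@zmatrix_comparison _ _ _
  (\col_j upper_barrier R N W (j + W))).
- exact: neg_laplacian_offdiag.
- by move=> i; rewrite mxE upper_barrier_gt0.
- by move=> i; apply: lt_le_trans (neg_laplacian_upper_barrier R i W0).
Qed.

Lemma neg_laplacian_unit (R : realType) (N W : nat) :
  (0 < W)%N -> neg_laplacian R N W \in unitmx.
Proof.
move=> W0; rewrite unitmxE unitfE; apply/det0P => -[v /eqP v0 vA].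
have Av : neg_laplacian R N W *m v^T = 0.
  by rewrite -neg_laplacian_sym -trmx_mul vA trmx0.
apply: v0; apply: trmx_inj; rewrite trmx0; move: Av.
apply: (@zmatrix_ker _ _ _ (\col_j upper_barrier R N W (j + W))).
- exact: neg_laplacian_offdiag.
- by move=> i; rewrite mxE upper_barrier_gt0.
- by move=> i; apply: lt_le_trans (neg_laplacian_upper_barrier R i W0).
Qed.

Lemma neg_laplacian_torsion (R : realType) (N W : nat) (i : 'I_N) :
  (0 < W)%N -> (neg_laplacian R N W *m torsion_function R N W) i 0 = 1.
Proof.
by move=> W0; rewrite /torsion_function mulKVmx ?neg_laplacian_unit// mxE.
Qed.

Lemma torsion_le_upper_barrier (R : realType) (N W : nat) (i : 'I_N) :
  (0 < W)%N -> torsion_function R N W i 0 <= upper_barrier R N W (i + W).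
Proof.
move=> W0; have := @neg_laplacian_comparison R N W
  (\col_j upper_barrier R N W (j + W) - torsion_function R N W) W0.
move=> /(_ _ i); rewrite !mxE subr_ge0; apply => j.
by rewrite mulmxBr mxE [X in _ + X]mxE neg_laplacian_torsion// subr_ge0
  neg_laplacian_upper_barrier.
Qed.

Lemma torsion_ge_lower_barrier (R : realType) (N W : nat) (i : 'I_N) :
  (0 < W)%N -> lower_barrier R N W (i + W) <= torsion_function R N W i 0.
Proof.
move=> W0; have := @neg_laplacian_comparison R N W
  (torsion_function R N W - \col_j lower_barrier R N W (j + W)) W0.
move=> /(_ _ i); rewrite !mxE subr_ge0; apply => j.
by rewrite mulmxBr mxE [X in _ + X]mxE neg_laplacian_torsion// subr_ge0
  neg_laplacian_lower_barrier.
Qed.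

Lemma torsion_ge0 (R : realType) (N W : nat) (i : 'I_N) :
  (0 < W)%N -> 0 <= torsion_function R N W i 0.
Proof.
move=> W0; apply: (neg_laplacian_comparison W0) => j.
by rewrite neg_laplacian_torsion.
Qed.

Lemma torsion_norm_le (R : realType) (N W : nat) : (0 < W)%N ->
  `|torsion_function R N W| <=
    (N + W + W).+1%:R ^+ 2 / (8 * band_moment R W).
Proof.
move=> W0; have s0 := band_moment_gt0 R W0.
have b0 : 0 <= (N + W + W).+1%:R ^+ 2 / (8 * band_moment R W).
  by rewrite divr_ge0 ?sqr_ge0// mulr_ge0// ltW.
have -> : `|torsion_function R N W| = mx_norm (torsion_function R N W) by [].
rewrite mx_normrE; apply: bigmax_le => // -[i j] _ /=.
rewrite ord1 ger0_norm ?torsion_ge0//.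
apply: le_trans (torsion_le_upper_barrier _ _ W0) _.
rewrite /upper_barrier -subr_ge0 -natr1.
set x := (i + W)%:R; set L := (N + W + W)%:R.
(* Completing the square around the vertex [(L - 1) / 2] of the parabola. *)
rewrite (_ : _ - _ = (L - 1 - 2 * x) ^+ 2 / (8 * band_moment R W)).
  by rewrite divr_ge0 ?sqr_ge0// mulr_ge0// ltW.
by field; rewrite gt_eqF.
Qed.

Lemma torsion_norm_ge (R : realType) (n W : nat) : (0 < W)%N ->
  (n.+2%:R ^+ 2 - 1) / (8 * band_moment R W) <=
    `|torsion_function R n.+1 W|.
Proof.
move=> W0; have s0 := band_moment_gt0 R W0.
have n2 : (n.+1./2 < n.+1)%N by lia.
pose i := Ordinal n2.
apply: (@le_trans _ _ (torsion_function R n.+1 W i 0)); last first.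
  have -> : `|torsion_function R n.+1 W| =
    mx_norm (torsion_function R n.+1 W) by [].
  rewrite mx_normrE; apply: le_trans (ler_norm _) _.
  exact: (le_bigmax _ (fun ij : _ * _ => `|torsion_function R n.+1 W ij.1 ij.2|)
    (i, 0)).
apply: le_trans _ (torsion_ge_lower_barrier R i W0).
have ih : (n.+1 = n.+1./2.*2 + odd n.+1)%N by lia.
have [x xE] : {x : R | x = (n.+1./2)%:R} by exists (n.+1./2)%:R.
have [e eE] : {e : R | e = (odd n.+1)%:R} by exists (odd n.+1)%:R.
have nE : n.+1%:R = 2 * x + e.
  by rewrite {1}ih natrD -mul2n natrM -xE -eE.
rewrite /lower_barrier -subr_ge0 /= !natrD -xE -[n.+2%:R]natr1 nE.
(* At the midpoint the two factors of the barrier multiply to [((n + 2)^2 - (1 - e)^2) / 4], with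
   [e] the parity of [n.+1]; the [- 1] in the bound absorbs the even case. *)
rewrite (_ : _ - _ = (1 - (1 - e) ^+ 2) / (8 * band_moment R W)).
  rewrite divr_ge0//; last by rewrite mulr_ge0// ltW.
  by rewrite eE; case: (odd n.+1) => /=; lra.
by field; rewrite gt_eqF.
Qed.

(** * Bounds on the smallest eigenvalue *)

Lemma neg_laplacian_eigenvalue_ge (R : realType) (N W : nat) (b : R) :
  eigenvalue (neg_laplacian R N W) b ->
  band_symbol W (pi / (N + W + W).+1%:R) <= b.
Proof.
set t : R := pi / _.
(* The frequency puts consecutive zeros of the sine at [-1] and [N + 2W], just outside the
   window. *)
have sin_gt0 p : (p < N + W + W)%N -> 0 < sin (t * (p%:R + 1)).
  move=> pN; apply: sin_gt0_pi; rewrite /t natr1 mulrAC; apply/andP; split.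
    by rewrite divr_gt0// mulr_gt0// pi_gt0.
  by rewrite ltr_pdivrMr// ltr_pM2l ?pi_gt0// ltr_nat.
apply: (@zmatrix_eigenvalue_ge _ _ _
  (\col_j (fun q => sin (t * (q%:R + 1))) (j + W)%N)).
- exact: neg_laplacian_sym.
- exact: neg_laplacian_offdiag.
- by move=> i; rewrite mxE sin_gt0//; have := ltn_ord i; lia.
- move=> i; rewrite [X in _ * X]mxE -second_differences_sin ?leq_addl//.
  by apply: neg_laplacian_ge => p pW; rewrite ltW// sin_gt0//; lia.
Qed.

(** The size [n.+1] is positive, so a smallest eigenvalue exists and [xget] does not return its
    default. *)
Lemma neg_laplacian_smallest_eigenvalueP (R : realType) (n W : nat) :
  is_smallest_eigenvalue (neg_laplacian R n.+1 W)
    (smallest_eigenvalue (neg_laplacian R n.+1 W)).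
Proof.
have [a aP _] := smallest_eigenvalue_symmetric (neg_laplacian_sym R n.+1 W).
by apply: xgetPex; exists a.
Qed.

Lemma neg_laplacian_smallest_eigenvalue_le (R : realType) (n W : nat) :
  (W <= n.+1)%N ->
  smallest_eigenvalue (neg_laplacian R n.+1 W) <= band_symbol W (pi / n.+2%:R).
Proof.
move=> Wn; set A := neg_laplacian R n.+1 W; set t : R := pi / _.
have [a [a_eig _] a_min] :=
  smallest_eigenvalue_symmetric (neg_laplacian_sym R n.+1 W).
apply: (@le_trans _ _ a).
  by have [_] := neg_laplacian_smallest_eigenvalueP R n W; apply.
(* Consecutive zeros at [W - 1] and [n.+1 + W], the inner ends of the layers. By [W <= n.+1], each
   layer stays within the adjacent half-period, where the sine is nonpositive. *)
pose g q := sin (t * (q%:R + (1 - W%:R))) : R.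
have tn (m : nat) : t * m%:R = pi * (m%:R / n.+2%:R).
  by rewrite /t mulrAC -mulrA.
have g_gt0 (i : 'I_n.+1) : 0 < g (i + W)%N.
  rewrite /g natrD [_ + (1 - _)]addrCA addrK addrC natr1 tn.
  apply: sin_gt0_pi; rewrite mulr_gt0 ?pi_gt0 ?divr_gt0//=.
  by rewrite gtr_pMr ?pi_gt0// ltr_pdivrMr// mul1r ltr_nat ltnS.
have g_le0 p : (p < W)%N || (n.+1 + W <= p < n.+1 + W + W)%N -> g p <= 0.
  rewrite /g addrA natr1; case: (ltnP p W) => pW /= pnW.
    rewrite -opprB -natrB// mulrN sinN oppr_le0 tn sin_ge0_pi//.
    rewrite mulr_ge0 ?pi_ge0 ?divr_ge0//= ger_pMr ?pi_gt0//.
    by rewrite ler_pdivrMr// mul1r ler_nat; lia.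
  rewrite (_ : p.+1%:R - W%:R = n.+2%:R + (p.+1 - W - n.+2)%N%:R); last first.
    by rewrite -natrB ?(leq_trans pW)// -natrD; congr (_%:R); lia.
  rewrite mulrDr !tn divff// mulr1 addrC sinDpi oppr_le0 sin_ge0_pi//.
  rewrite mulr_ge0 ?pi_ge0 ?divr_ge0//= ger_pMr ?pi_gt0//.
  by rewrite ler_pdivrMr// mul1r ler_nat; lia.
pose x := \row_(j < n.+1) g (j + W)%N.
have xT : x^T = \col_j g (j + W)%N by apply/colP => j; rewrite !mxE.
have x_gt0 : 0 < (x *m x^T) 0 0.
  rewrite row_normsqE big_ord_recl ltr_wpDr//.
    by apply: sumr_ge0 => i _; exact: sqr_ge0.
  by rewrite mxE exprn_gt0.
(* The Rayleigh quotient is bounded term by term: each entry of [x] is positive and multiplies a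
   subsolution inequality. *)
rewrite -(ler_pM2r x_gt0); apply: le_trans (a_min x) _.
rewrite row_normsqE mulr_sumr -mulmxA mxE; apply: ler_sum => i _.
rewrite mxE expr2 mulrCA ler_pM2l// xT.
apply: le_trans (neg_laplacian_le _ g_le0) _.
by rewrite second_differences_sin ?leq_addl.
Qed.

(** * Asymptotics of the bounds and the limit *)

Lemma cvg_sin_div (R : realType) : sin h / h @[h --> (0 : R)^'] --> (1 : R).
Proof.
(* The quotient is the difference quotient of the sine at 0, with limit [cos 0]. *)
have := ex_derive (is_derive := is_derive_sin (0 : R)).
rewrite /derivable -[lim _]/('D_1 (@sin R) 0) derive_val cos0.
rewrite (_ : (fun _ => _) = fun h : R => sin h / h)//.
by apply/funext => h /=; rewrite sin0 subr0 addr0 [h *: _]mulr1 [_ *: _]mulrC.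
Qed.

Lemma cvg_inv_addn (R : realType) (c : nat) :
  (n + c.+1)%:R^-1 @[n --> \oo] --> (0 : R).
Proof.
under eq_fun do rewrite addnS.
by have := @cvg_harmonic R; rewrite -(cvg_shiftn c).
Qed.

Lemma cvg_ratio_addn (R : realType) (a b : nat) :
  (n + a)%:R / (n + b.+1)%:R @[n --> \oo] --> (1 : R).
Proof.
rewrite (_ : (fun _ => _) =
    fun n => 1 + (a%:R - b.+1%:R) * (n + b.+1)%:R^-1); last first.
  apply/funext => n; have M0 : (n + b.+1)%:R != 0 :> R.
    by rewrite pnatr_eq0 addnS.
  rewrite -[X in X + _](divff M0) -mulrDl; congr (_ / _).
  by rewrite !natrD; ring.
rewrite -[X in _ --> X]addr0 -[X in _ --> _ + X](mulr0 (a%:R - b.+1%:R)).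
apply: cvgD; first exact: cvg_cst.
by apply: cvgM; [exact: cvg_cst | exact: cvg_inv_addn].
Qed.

(** The identity [2 - 2 cos (2x) = 4 sin^2 x] brings out the factor [t ^+ 2] and quotients
    [sin x / x] that tend to 1. *)
Lemma band_symbolE (R : realType) (W : nat) (t : R) : t != 0 ->
  band_symbol W t = t ^+ 2 *
    \sum_(k < W) k.+1%:R ^+ 2 *
      (sin (t * k.+1%:R / 2) / (t * k.+1%:R / 2)) ^+ 2.
Proof.
move=> t0; rewrite mulr_sumr; apply: eq_bigr => k _.
have k0 : k.+1%:R != 0 :> R by rewrite pnatr_eq0.
set x := t * k.+1%:R / 2; have -> : t * k.+1%:R = x *+ 2.
  by rewrite /x -[RHS]mulr_natr divfK// pnatr_eq0.
rewrite cos_mulr2n cos2sin2 /x; field.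
by rewrite -natr1 in k0; rewrite t0 addrC natr1 pnatr_eq0.
Qed.

Lemma cvg_band_symbol (R : realType) (W c : nat) :
  band_symbol W (pi / (n + c.+1)%:R) * (n + c.+1)%:R ^+ 2 @[n --> \oo] -->
  pi ^+ 2 * band_moment R W.
Proof.
have M0 n : (n + c.+1)%:R != 0 :> R by rewrite pnatr_eq0 addnS.
have pi0 : pi != 0 :> R by rewrite gt_eqF// pi_gt0.
rewrite (_ : (fun _ => _) = fun n => pi ^+ 2 *
  \sum_(k < W) k.+1%:R ^+ 2 * (sin (pi / (n + c.+1)%:R * k.+1%:R / 2) /
    (pi / (n + c.+1)%:R * k.+1%:R / 2)) ^+ 2); last first.
  apply/funext => n; rewrite band_symbolE ?mulf_neq0 ?invr_neq0//.
  by rewrite mulrAC expr_div_n divfK// expf_neq0.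
apply: cvgM; first exact: cvg_cst.
have -> : band_moment R W = \sum_(k < W) k.+1%:R ^+ 2 * (1 * 1).
  by apply: eq_bigr => k _; rewrite !mulr1.
apply: (cvg_big (@add_continuous R)) => k _.
apply: cvgM; first exact: cvg_cst.
have /cvgr_dnbhsP sinc := @cvg_sin_div R.
have term_cvg : sin (pi / (n + c.+1)%:R * k.+1%:R / 2) /
    (pi / (n + c.+1)%:R * k.+1%:R / 2) @[n --> \oo] --> (1 : R).
  apply: (sinc (fun n => pi / (n + c.+1)%:R * k.+1%:R / 2)); split.
    by move=> n; rewrite !mulf_neq0 ?invr_neq0// pnatr_eq0.
  rewrite (_ : (fun _ => _) =
    fun n => pi * k.+1%:R / 2 * (n + c.+1)%:R^-1); last first.
    by apply/funext => n; ring.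
  rewrite -[X in _ --> X](mulr0 (pi * k.+1%:R / 2)).
  by apply: cvgM; [exact: cvg_cst | exact: cvg_inv_addn].
exact: (cvgM term_cvg term_cvg).
Qed.

Theorem theorem3 (R : realType) (W : nat) (hW : (0 < W)%N) :
  smallest_eigenvalue (neg_laplacian R N W) * `|torsion_function R N W|
    @[N --> \oo] --> pi ^+ 2 / 8.

Proof.
have s0 := band_moment_gt0 R hW.
set s := band_moment R W in s0.
(* Products of the two lower bounds and of the two upper bounds, for matrix size [n.+1]. The
   constant [s] cancels in the limit: the symbol behaves like [s pi^2 / n^2] and the norm bound like
   [n^2 / (8 s)]. *)
pose lower n : R := band_symbol W (pi / (n.+1 + W + W).+1%:R) *
  ((n.+2%:R ^+ 2 - 1) / (8 * s)).
pose upper n : R := band_symbol W (pi / n.+2%:R) *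
  ((n.+1 + W + W).+1%:R ^+ 2 / (8 * s)).
have addW n : (n.+1 + W + W).+1 = (n + (W + W).+2)%N by lia.
rewrite -cvg_shiftS; apply: (@squeeze_cvgr _ _ _ _ lower upper).
- near=> n; have Wn : (W <= n.+1)%N by near: n; exists W => // m /= /leqW.
  have [l_eig _] := neg_laplacian_smallest_eigenvalueP R n W.
  have l_ge := neg_laplacian_eigenvalue_ge l_eig.
  have l_le := neg_laplacian_smallest_eigenvalue_le R Wn.
  have u_ge := torsion_norm_ge R n hW.
  have u_le := torsion_norm_le R n.+1 hW.
  have sym_ge0 (t : R) : 0 <= band_symbol W t.
    by apply: sumr_ge0 => k _; have := cos_le1 (t * k.+1%:R); lra.
  apply/andP; split.
    apply: ler_pM => //; rewrite divr_ge0 ?subr_ge0 ?exprn_ege1 ?ler1n//.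
    by rewrite mulr_ge0// ltW.
  apply: ler_pM => //; exact: le_trans l_ge.
(* With [M = n + 2W + 2], inserting [M^2 / M^2] separates the convergent factor
   [band_symbol W (pi / M) * M^2] from ratios tending to 1 and 0. *)
- rewrite (_ : lower = fun n => band_symbol W (pi / (n + (W + W).+2)%:R) *
      (n + (W + W).+2)%:R ^+ 2 *
      (((n + 2)%:R / (n + (W + W).+2)%:R) ^+ 2 - (n + (W + W).+2)%:R^-1 ^+ 2) /
      (8 * s)); last first.
    apply/funext => n; rewrite /lower addW addn2.
    have : (n + (W + W).+2)%:R != 0 :> R by rewrite pnatr_eq0 addnS.
    by move: (n + _)%:R n.+2%:R => M m M0; field; rewrite M0 gt_eqF.
  rewrite (_ : pi ^+ 2 / 8 = pi ^+ 2 * s * (1 ^+ 2 - 0 ^+ 2) / (8 * s)).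
    apply: cvgM; last exact: cvg_cst.
    apply: cvgM; first exact: cvg_band_symbol.
    apply: cvgB; rewrite !expr2; apply: cvgM; try exact: cvg_ratio_addn.
      exact: cvg_inv_addn.
    exact: cvg_inv_addn.
  by field; rewrite gt_eqF.
(* The same splitting with [n + 2] in place of [M]. *)
- rewrite (_ : upper = fun n => band_symbol W (pi / (n + 2)%:R) *
      (n + 2)%:R ^+ 2 * ((n + (W + W).+2)%:R / (n + 2)%:R) ^+ 2 / (8 * s));
      last first.
    apply/funext => n; rewrite /upper addW addn2.
    have : n.+2%:R != 0 :> R by rewrite pnatr_eq0.
    by move: (n + _)%:R n.+2%:R => M m m0; field; rewrite m0 gt_eqF.
  rewrite (_ : pi ^+ 2 / 8 = pi ^+ 2 * s * 1 ^+ 2 / (8 * s)).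
    apply: cvgM; last exact: cvg_cst.
    apply: cvgM; first exact: cvg_band_symbol.
    by rewrite !expr2; apply: cvgM; exact: cvg_ratio_addn.
  by field; rewrite gt_eqF.
Unshelve. all: by end_near.
Qed.
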